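(* Let $\epsilon,\delta>0$, $\Delta_1>0$, let $T$ be the number of iterations of the column-private LP algorithm (described in the context) and $\epsilon'=\epsilon/(4\sqrt{T\log(1/\delta)})$. The column-private LP algorithm, run with an $\epsilon'$-differentially private dual oracle (with respect to the neighbor relation below), is $(\epsilon,\delta)$-low sensitivity column private with sensitivity $\Delta_1$.
   Context: Inputs: $A\in[-1,1]^{m\times d}$, $b\in\mathbb{R}^m$; $A_i$ is the $i$-th row. A randomized algorithm $\mathcal{M}(b,A)$ with output in $\mathbb{R}^d$ is $(\epsilon,\delta)$-low sensitivity column private with sensitivity $\Delta_1$ if for all $A,A'$ with $\|A_i-A'_i\|_1\le\Delta_1$ for every row $i\in[m]$, and all $S\subseteq\mathbb{R}^d$, $\Pr[\mathcal{M}(b,A)\in S]\le e^\epsilon\Pr[\mathcal{M}(b,A')\in S]+\delta$. An $(\alpha,\gamma)$-dual oracle, given $A,b,x$, outputs $i\in[m]$ with $A_ix-b_i\ge\max_j(A_jx-b_j)-\alpha$ with probability at least $1-\gamma$. $\mathrm{Lap}(\lambda)$ has density $\frac1{2\lambda}e^{-|\nu|/\lambda}$. Column-private LP algorithm (accuracy parameter $\alpha$): $T=144\log d/\alpha^2$, $\eta=\sqrt{\log d/T}$, $\tilde x^1$ uniform on $[d]$. For $t=1,\dots,T$: $p^t=\mathrm{Oracle}(A,b,\tilde x^t)$; for each $i\in[d]$, $\hat\ell^t_i=\frac12(A_{p^ti}+\nu^t_i)$ with independent $\nu^t_i\sim\mathrm{Lap}(\Delta_1/\epsilon')$; $x^{t+1}_i=e^{-\eta\hat\ell^t_i}\tilde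 x^t_i$; $\tilde x^{t+1}=x^{t+1}/\sum_ix^{t+1}_i$. Output $\bar x=\frac1T\sum_t\tilde x^t$.
   Formalization: The formal theorem adds the hypothesis ε ≤ 8 log(1/δ) (which forces δ < 1); without a condition tying ε and δ the claim fails, e.g. for ε = 1 and δ very close to 1, where ε' is huge and the Laplace noise is negligible. *)

(* Defs.v *)
From HB Require Import structures.
From mathcomp Require Import all_boot all_order all_algebra.
From mathcomp Require Import all_classical all_reals all_analysis measurable_realfun.

Set Implicit Arguments.
Unset Strict Implicit.
Unset Printing Implicit Defensive.

Import Order.TTheory GRing.Theory Num.Theory.
Import numFieldNormedType.Exports.

Local Open Scope classical_set_scope.
Local Open Scope ring_scope.

HB.instance Definition _ (m : nat) := isPointed.Build 'I_m.+1 ord0.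
HB.instance Definition _ (m : nat) := @isMeasurable.Build
  default_measure_display 'I_m.+1 discrete_measurable discrete_measurable0
  discrete_measurableC discrete_measurableU.

Lemma measurable_inv {R : realType} : measurable_fun [set: R] (@GRing.inv R).
Proof.
have m0 : measurable [set x : R | x != 0].
  rewrite (_ : mkset _ = ~` [set 0]); first exact: measurableC.
  by apply/seteqP; split=> x /eqP.
have -> : [set: R] = [set 0] `|` [set x : R | x != 0].
  by apply/seteqP; split=> x //= _; have [->|] := eqVneq x 0; [left|right].
apply/measurable_funU => //; split; first exact: measurable_fun_set1.
apply: open_continuous_measurable_fun; first exact: open_neq.
by move=> x; rewrite inE/= => x0; exact: inv_continuous.
Qed.

Section laplace.
Context {R : realType}.
Notation mu := (@lebesgue_measure R).

(* Only [0 < l] is meaningful; the other branch makes [laplace_prob l] a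
   probability measure for every [l], as the library does for [normal_pdf]. *)
Definition laplace_pdf (l x : R) : R :=
  if 0 < l then (2 * l)^-1 * expR (- `|x| / l) else \1_`[0, 1] x.

Definition laplace_prob (l : R) : set R -> \bar R :=
  fun V => (\int[mu]_(x in V) (laplace_pdf l x)%:E)%E.

Lemma laplace_pdf_ge0 l x : 0 <= laplace_pdf l x.
Proof.
rewrite /laplace_pdf; case: ifPn => // l0.
by rewrite mulr_ge0 ?expR_ge0// invr_ge0 mulr_ge0// ltW.
Qed.

Lemma measurable_laplace_pdf l : measurable_fun [set: R] (laplace_pdf l).
Proof.
rewrite /laplace_pdf; case: (0 < l); last exact: measurable_indic.
apply: measurable_funM => //; apply: measurableT_comp => //.
apply: measurable_funM => //; apply: measurable_funN.
exact: normr_measurable.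
Qed.

Lemma continuous_laplace_pdf l : 0 < l -> continuous (laplace_pdf l).
Proof.
move=> l0; rewrite /laplace_pdf l0 => x.
apply: cvgM; first exact: cvg_cst.
apply: (cvg_comp _ expR); last exact: continuous_expR.
apply: cvgM; last exact: cvg_cst.
by apply: (@cvgN _ R^o); exact: (@norm_continuous _ R^o).
Qed.

Lemma integral_laplace_pdf l : (\int[mu]_x (laplace_pdf l x)%:E = 1)%E.
Proof.
have [l0|l0] := ltP 0 l; last first.
  rewrite /laplace_pdf ltNge l0/= integral_indic//= setIT.
  by rewrite lebesgue_measure_itv/= lte_fin ltr01 oppr0 adde0.
have li0 : 0 < l^-1 by rewrite invr_gt0.
rewrite ge0_symfun_integralT; last 3 first.
- exact: laplace_pdf_ge0.
- exact: continuous_laplace_pdf.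
- by move=> x; rewrite /laplace_pdf/= l0 normrN.
rewrite -set_itvcy (_ : (\int[mu]_(x in _) (laplace_pdf l x)%:E)%E =
  \int[mu]_(x in `[0%R, +oo[) (2^-1%:E * (exponential_pdf l^-1 x)%:E))%E; last first.
  apply: eq_integral => x; rewrite inE/= in_itv/= andbT => x0.
  rewrite -EFinM; congr EFin; rewrite /laplace_pdf l0 exponential_pdfE//.
  by rewrite ger0_norm// invfM mulrA [- x / l]mulrC mulrN mulNr.
rewrite ge0_integralZl//=; last 2 first.
- by apply/measurable_funTS/measurable_EFinP; exact: measurable_exponential_pdf.
- by move=> x _; rewrite lee_fin exponential_pdf_ge0// ltW.
rewrite muleA -EFinM divff// mul1e -[RHS](integral_exponential_pdf li0).
rewrite integral_mkcond; apply: eq_integral => x _.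
rewrite patchE; case: ifPn => // x0; rewrite lt0_exponential_pdf//.
by move: x0; rewrite notin_setE/= in_itv/= andbT => /negP; rewrite -ltNge.
Qed.

Variable l : R.

Let laplace0 : laplace_prob l set0 = 0%E.
Proof. exact: integral_set0. Qed.

Let laplace_ge0 A : (0 <= laplace_prob l A)%E.
Proof. by apply: integral_ge0 => x _; rewrite lee_fin laplace_pdf_ge0. Qed.

Let laplace_sigma_additive : semi_sigma_additive (laplace_prob l).
Proof.
move=> /= F mF tF mUF; rewrite /laplace_prob; apply: cvg_toP.
  apply: ereal_nondecreasing_is_cvgn => m n mn.
  apply: lee_sum_nneg_natr => // k _ _; apply: integral_ge0 => /= x Fkx.
  by rewrite lee_fin laplace_pdf_ge0.
rewrite ge0_integral_bigcup//=.
- apply/measurable_funTS/measurable_EFinP; exact: measurable_laplace_pdf.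
- by move=> x _; rewrite lee_fin laplace_pdf_ge0.
Qed.

HB.instance Definition _ := isMeasure.Build _ _ _
  (laplace_prob l) laplace0 laplace_ge0 laplace_sigma_additive.

Let laplace_setT : laplace_prob l [set: R] = 1%E.
Proof. exact: integral_laplace_pdf. Qed.

HB.instance Definition _ :=
  Measure_isProbability.Build _ _ _ (laplace_prob l) laplace_setT.

End laplace.

Section iid.
Context {R : realType}.

Definition tcons n (y : R * n.-tuple R) : n.+1.-tuple R := [tuple of y.1 :: y.2].

Lemma measurable_tcons n : measurable_fun [set: R * n.-tuple R] (@tcons n).
Proof. exact: measurable_cons. Qed.

HB.instance Definition _ n :=
  isMeasurableFun.Build _ _ _ _ (@tcons n) (@measurable_tcons n).

(* Joint law of [n] independent random variables of law [P]. *)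
Fixpoint iid (P : probability R R) n : probability (n.-tuple R) R :=
  if n is n'.+1 then distribution (P \x iid P n')%E (@tcons n')
  else \d_[tuple].

End iid.

(* Kernel counterpart of monadic bind: draw [y] from [l x], then from
   [k (x, y)]. *)
Section pkbind.
Context {R : realType} d1 d2 d3 (X : measurableType d1) (Y : measurableType d2)
  (Z : measurableType d3).
Variables (l : R.-pker X ~> Y) (k : R.-pker (X * Y) ~> Z).

Definition pkbind : X -> {measure set Z -> \bar R} := mkcomp l k.

HB.instance Definition _ := Kernel.on pkbind.

Let pkbind_setT x : pkbind x [set: Z] = 1%E.
Proof.
rewrite /pkbind /mkcomp /= /kcomp -[RHS](@prob_kernel _ _ _ _ _ l x).
by rewrite (eq_integral (cst 1%E)) ?integral_cst ?mul1e// => y _; exact: prob_kernel.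
Qed.

HB.instance Definition _ :=
  Kernel_isProbability.Build _ _ _ _ _ pkbind pkbind_setT.

End pkbind.

Section pkpre.
Context {R : realType} d1 d2 d3 (X : measurableType d1) (Y : measurableType d2)
  (Z : measurableType d3).
Variables (k : R.-pker Y ~> Z) (f : {mfun X >-> Y}).

Definition pkpre : X -> {measure set Z -> \bar R} := fun x => k (f x).

Let measurable_pkpre U : measurable U -> measurable_fun [set: X] (pkpre ^~ U).
Proof.
by move=> mU; apply: (measurableT_comp (measurable_kernel k U mU)).
Qed.

HB.instance Definition _ := isKernel.Build _ _ _ _ _ pkpre measurable_pkpre.

Let pkpre_setT x : pkpre x [set: Z] = 1%E.
Proof. exact: prob_kernel. Qed.

HB.instance Definition _ :=
  Kernel_isProbability.Build _ _ _ _ _ pkpre pkpre_setT.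

End pkpre.

Section pkcst.
Context {R : realType} d1 d2 (X : measurableType d1) (Y : measurableType d2).
Variable P : probability Y R.

Definition pkcst : X -> {measure set Y -> \bar R} := fun=> P.

Let measurable_pkcst U : measurable U -> measurable_fun [set: X] (pkcst ^~ U).
Proof. by move=> mU; exact: measurable_cst. Qed.

HB.instance Definition _ := isKernel.Build _ _ _ _ _ pkcst measurable_pkcst.

Let pkcst_setT x : pkcst x [set: Y] = 1%E.
Proof. exact: probability_setT. Qed.

HB.instance Definition _ :=
  Kernel_isProbability.Build _ _ _ _ _ pkcst pkcst_setT.

End pkcst.

Section pklaw.
Context {R : realType} d1 d2 (X : measurableType d1) (Y : measurableType d2).
Variables (k : R.-pker X ~> Y) (x : X).

(* A probability kernel at a point, as an element of [probability Y R]. *)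
Definition pklaw : set Y -> \bar R := k x.

HB.instance Definition _ := Measure.on pklaw.

Let pklaw_setT : pklaw [set: Y] = 1%E.
Proof. exact: prob_kernel. Qed.

HB.instance Definition _ :=
  Measure_isProbability.Build _ _ _ pklaw pklaw_setT.

End pklaw.

Section privacy.
Context {R : realType}.

Definition unit_bounded m n (A : 'M[R]_(m, n)) : Prop :=
  forall i j, -1 <= A i j <= 1.

Definition row_close m n (D1 : R) (A A' : 'M[R]_(m, n)) : Prop :=
  forall i, \sum_j `|A i j - A' i j| <= D1.

(* [M b A] is the law of the output of the mechanism on input [(b, A)]. *)
Definition low_sensitivity_column_private m n d (Y : measurableType d)
    (D1 eps delta : R) (M : 'cV[R]_m -> 'M[R]_(m, n) -> probability Y R) : Prop :=
  forall b A A', unit_bounded A -> unit_bounded A' -> row_close D1 A A' ->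
  forall S, measurable S ->
    (M b A S <= (expR eps)%:E * M b A' S + delta%:E)%E.

End privacy.

Section column_private_lp.
Context {R : realType} (m n : nat).
Local Notation vec := (n.-tuple R).
Local Notation row := 'I_m.+1.

Definition simplex (x : vec) : Prop :=
  (forall i, 0 <= tnth x i) /\ \sum_i tnth x i = 1.

(* For each [b] and [A], a Markov kernel from the query point to the rows
   (there is at least one row, since an oracle has to return one). *)
Definition oracle := 'cV[R]_m.+1 -> 'M[R]_(m.+1, n) -> R.-pker vec ~> row.

Implicit Types (b : 'cV[R]_m.+1) (A : 'M[R]_(m.+1, n)) (x : vec) (orc : oracle).

Definition violation b A x (j : row) : R :=
  \sum_i A j i * tnth x i - b j ord0.

(* Oracle guarantees are only required at query points that are probability
   vectors, the only points at which the algorithm calls the oracle: the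
   sensitivity of [A *m x] in [A] is bounded on the simplex but not on the whole
   space. *)
Definition dual_oracle (alpha gamma : R) orc : Prop :=
  forall b A x, unit_bounded A -> simplex x ->
    ((1 - gamma)%:E <= orc b A x [set i |
       \big[Num.max/violation b A x ord0]_j violation b A x j - alpha
         <= violation b A x i]%R)%E.

Definition private_oracle (D1 eps : R) orc : Prop :=
  forall x, simplex x ->
    low_sensitivity_column_private D1 eps 0 (fun b A => pklaw (orc b A) x).

(* Rounded up to an integer; it is [0] for [n <= 1]. *)
Definition num_iter (alpha : R) : nat :=
  `|Num.ceil (144 * ln n%:R / alpha ^+ 2)|%N.

Section iteration.
Variables (alpha : R) (noise : R) (orc : oracle) (b : 'cV[R]_m.+1)
  (A : 'M[R]_(m.+1, n)).

Local Notation T := (num_iter alpha).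

Definition eta : R := Num.sqrt (ln n%:R / T%:R).

Definition noisy_loss (p : row) (nu : vec) (i : 'I_n) : R :=
  2^-1 * (A p i + tnth nu i).

Definition mw_weight x (p : row) (nu : vec) (i : 'I_n) : R :=
  expR (- eta * noisy_loss p nu i) * tnth x i.

Definition mw_update x (p : row) (nu : vec) : vec :=
  [tuple mw_weight x p nu i / \sum_j mw_weight x p nu j | i < n].

(* Current iterate, and sum of the iterates preceding it. *)
Local Notation state := (vec * vec)%type.

Definition next_state (y : (state * row) * vec) : state :=
  (mw_update y.1.1.1 y.1.2 y.2,
   [tuple tnth y.1.1.2 i + tnth y.1.1.1 i | i < n]).

Definition average (y : state) : vec := [tuple T%:R^-1 * tnth y.2 i | i < n].

Definition cur_iterate (y : state) : vec := y.1.

Lemma measurable_noisy_loss i :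
  measurable_fun [set: (state * row) * vec] (fun y => noisy_loss y.1.2 y.2 i).
Proof.
apply: measurable_funM => //; apply: measurable_funD.
  apply: (@measurableT_comp _ _ _ _ _ _ (fun p : row => A p i)) => //.
  exact: measurableT_comp.
by apply: (measurableT_comp (measurable_tnth i)).
Qed.

Lemma measurable_mw_weight i : measurable_fun [set: (state * row) * vec]
  (fun y => mw_weight y.1.1.1 y.1.2 y.2 i).
Proof.
apply: measurable_funM.
  apply: measurableT_comp => //; apply: measurable_funM => //.
  exact: measurable_noisy_loss.
apply: (measurableT_comp (measurable_tnth i)).
by do 2 apply: measurableT_comp => //.
Qed.

Lemma measurable_next_state : measurable_fun [set: (state * row) * vec] next_state.
Proof.
apply/measurable_fun_pairP; split; apply/measurable_fun_tnthP => i.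
  rewrite (_ : _ \o _ = fun y => mw_weight y.1.1.1 y.1.2 y.2 i *
     (\sum_j mw_weight y.1.1.1 y.1.2 y.2 j)^-1); last first.
    by apply/funext => y /=; rewrite tnth_mktuple.
  apply: measurable_funM; first exact: measurable_mw_weight.
  apply: measurableT_comp; first exact: measurable_inv.
  by apply: measurable_sum => j; exact: measurable_mw_weight.
rewrite (_ : _ \o _ = fun y => tnth y.1.1.2 i + tnth y.1.1.1 i); last first.
  by apply/funext => y /=; rewrite tnth_mktuple.
by apply: measurable_funD; apply: (measurableT_comp (measurable_tnth i));
  do 2 apply: measurableT_comp => //.
Qed.

HB.instance Definition _ :=
  isMeasurableFun.Build _ _ _ _ next_state measurable_next_state.

Lemma measurable_average : measurable_fun [set: state] average.
Proof.
apply/measurable_fun_tnthP => i.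
rewrite (_ : _ \o _ = fun y => T%:R^-1 * tnth y.2 i); last first.
  by apply/funext => y /=; rewrite tnth_mktuple.
apply: measurable_funM => //.
by apply: (measurableT_comp (measurable_tnth i)).
Qed.

Lemma measurable_cur_iterate : measurable_fun [set: state] cur_iterate.
Proof. exact: measurable_fst. Qed.

HB.instance Definition _ :=
  isMeasurableFun.Build _ _ _ _ cur_iterate measurable_cur_iterate.

(* Law of the output when [k] iterations remain: query the oracle at the
   current iterate, draw the noise vector, update, and continue. *)
Fixpoint lp_run (k : nat) : R.-pker state ~> vec :=
  if k is k'.+1 then
    pkbind (pkpre (orc b A) cur_iterate)
      (pkbind (pkcst (iid (laplace_prob noise) n))
         (pkpre (lp_run k') next_state))
  else kdirac measurable_average.

Lemma lp_runS k (s : state) U : lp_run k.+1 s U =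
  (\int[orc b A s.1]_p \int[iid (laplace_prob noise) n]_nu
     lp_run k (next_state ((s, p), nu)) U)%E.
Proof. by []. Qed.

Definition initial_state : state :=
  ([tuple n%:R^-1 | i < n], [tuple 0 | i < n]).

Definition lp_output : probability vec R := pklaw (lp_run T) initial_state.

End iteration.

Definition iter_eps (alpha eps delta : R) : R :=
  eps / (4 * Num.sqrt ((num_iter alpha)%:R * ln delta^-1)).

Definition column_private_lp (alpha D1 eps' : R) orc b A : probability vec R :=
  lp_output alpha (D1 / eps') orc b A.

End column_private_lp.

Arguments oracle : clear implicits.

(* Main.v *)
From HB Require Import structures.
Require Import Defs.
From mathcomp Require Import all_boot all_order all_algebra.
From mathcomp Require Import all_classical all_reals all_analysis measurable_realfun.
From mathcomp Require Import ring lra.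

(* Everything is measured by the Renyi divergence of order [a > 1], with
   [b = 1 - 1 / a]: a bound [a * rho] on it makes the probabilities [x] and [y]
   of an event under the two laws satisfy
   [x <= expR ((a - 1) * rho) * y `^ b].  A pure [e]-private step, be it a call
   to the oracle or a Laplace noise vector, costs [rho = e ^+ 2 / 2], the extreme
   case being randomized response.  By induction on the remaining iterations, [T]
   iterations cost [rho = T * e ^+ 2], which is [eps ^+ 2 / (16 L)] for
   [L = ln delta^-1].  Taking [a = 1 + 4 L / eps], weighted AM-GM turns the bound
   into [x <= expR eps * y + delta], using [eps <= 8 L]. *)

Set Implicit Arguments.
Unset Strict Implicit.
Unset Printing Implicit Defensive.

Import Order.TTheory GRing.Theory Num.Theory.
Import numFieldNormedType.Exports.

Local Open Scope classical_set_scope.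
Local Open Scope ring_scope.

(** * Gaussian domination of the hyperbolic cosine *)

Section cosh.
Context {R : realType}.
Implicit Types x y : R.

Lemma is_derive_ge0_ndecr (f df : R -> R) x y :
  (forall z : R, is_derive z 1 f (df z)) -> (forall z, x <= z -> 0 <= df z) ->
  x <= y -> f x <= f y.
Proof.
move=> fdf df0 xy; rewrite -subr_ge0.
have cf : {within `[x, y], continuous f}.
  apply: derivable_within_continuous => z _.
  by have := fdf z; case.
have [c] := MVT_segment xy (fun z _ => fdf z) cf.
rewrite in_itv/= => /andP[xc _] ->.
by rewrite mulr_ge0 ?subr_ge0// df0.
Qed.

(** This is [tanh x <= x] cleared of denominators. The difference vanishes at [0], and its
    derivative is nonnegative because [1 - 2 * z <= expR (- (2 * z))]. *)
Lemma expR_pade_le x : 0 <= x -> (1 - x) * expR (2 * x) <= 1 + x.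
Proof.
move=> x0; rewrite -subr_ge0.
pose f z : R := 1 + z - (1 - z) * expR (2 * z).
pose df z : R := 1 - (1 - 2 * z) * expR (2 * z).
rewrite (_ : 0 = f 0); last by rewrite /f mulr0 expR0 addr0 subr0 mul1r subrr.
apply: (@is_derive_ge0_ndecr f df) => // z.
  by rewrite /f; apply: is_derive_eq; rewrite /df /GRing.scale/=; ring.
move=> z0; rewrite /df subr_ge0.
have /(ler_wpM2r (expR_ge0 (2 * z))) := expR_ge1Dx (- (2 * z)).
by rewrite -expRD addNr expR0.
Qed.

(** The quotient of [cosh z] by [expR (z ^+ 2 / 2)] decreases for [0 <= z], its logarithmic
    derivative being [tanh z - z]. *)
Lemma cosh_gauss_le x y : 0 <= y -> y <= x ->
  (expR x + expR (- x)) * expR (y ^+ 2 / 2) <=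
  (expR y + expR (- y)) * expR (x ^+ 2 / 2).
Proof.
move=> y0 yx.
pose f z : R := - ((expR z + expR (- z)) * expR (- (z ^+ 2 / 2))).
pose df z : R := expR (- z) * expR (- (z ^+ 2 / 2)) *
  ((1 + z) - (1 - z) * expR (2 * z)).
have fdf (z : R) : is_derive z 1 f (df z).
  rewrite /f; apply: is_derive_eq.
  rewrite /df /GRing.scale/= (_ : 2 * z = z + z); last by ring.
  rewrite expRD expRN; have := expR_gt0 z; set e := expR z => e0.
  by field; rewrite gt_eqF.
have : f y <= f x.
  apply: is_derive_ge0_ndecr fdf _ yx => z yz.
  rewrite /df !mulr_ge0 ?expR_ge0// subr_ge0 expR_pade_le//.
  exact: le_trans yz.
rewrite /f lerN2 => /(ler_wpM2r (expR_ge0 (x ^+ 2 / 2 + y ^+ 2 / 2))).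
by rewrite -!mulrA -!expRD addrA addNr add0r addrCA addNr addr0.
Qed.

End cosh.

(** * Randomized response, and tangents of a concave power *)

Section two_point.
Context {R : realType}.
Variable a : R.
Hypothesis a_gt1 : 1 < a.

Let a_gt0 : 0 < a. Proof. exact: lt_trans a_gt1. Qed.

Let b := 1 - a^-1.

Let b_gt0 : 0 < b.
Proof. by rewrite subr_gt0 invf_lt1. Qed.

Let ab : a * b = a - 1.
Proof. by rewrite /b mulrBr mulr1 divff ?gt_eqF. Qed.

(** The left side is the Renyi moment, the sum of [P ^ a * Q ^ (1 - a)], for the two laws of
    randomized response. In terms of [x] and [y] it equals [cosh x / cosh y]. *)
Lemma randomized_response_renyi (e : R) : 0 <= e ->
  (expR (a * e) + expR (- ((a - 1) * e))) / (1 + expR e) <=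
  expR (a * (a - 1) * (e ^+ 2 / 2)).
Proof.
move=> e0.
pose y := e / 2; pose x := (a - 2^-1) * e.
have y0 : 0 <= y by rewrite divr_ge0.
have yx : y <= x.
  rewrite -subr_ge0 (_ : x - y = (a - 1) * e); last by rewrite /x /y; field.
  by rewrite mulr_ge0// subr_ge0 ltW.
have := cosh_gauss_le y0 yx.
rewrite ler_pdivrMr; last by rewrite addr_gt0 ?expR_gt0.
have -> : a * e = x + y by rewrite /x /y; field.
have -> : - ((a - 1) * e) = - x + y by rewrite /x /y; field.
have -> : e = y + y by rewrite /y; field.
have -> : a * (a - 1) * ((y + y) ^+ 2 / 2) = x ^+ 2 / 2 - y ^+ 2 / 2.
  by rewrite /x /y; field.
rewrite !expRD -mulrDl !expRN.
move: (expR y) (expR_gt0 y) (expR (y ^+ 2 / 2)) (expR_gt0 (y ^+ 2 / 2)).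
move: (expR x + _) (expR (x ^+ 2 / 2)) => X V Y Y0 U U0 H.
rewrite (_ : 1 + Y * Y = (Y + Y^-1) * Y); last by field; rewrite gt_eqF.
rewrite mulrA ler_pM2r// -(ler_pM2r U0) (le_trans H)//.
by rewrite [leRHS]mulrAC divfK ?gt_eqF// mulrC.
Qed.

(** Hölder's inequality with exponents [a] and [b^-1] passes from the mean of a power under one law
    to the power of the mean under the other, at the price of the [a]-th root of the Renyi
    moment. *)
Lemma randomized_response_powR (e m1 m0 : R) : 0 <= e -> 0 <= m1 -> 0 <= m0 ->
  (expR e * m1 `^ b + m0 `^ b) / (1 + expR e) <=
  expR ((a - 1) * (e ^+ 2 / 2)) * ((m1 + expR e * m0) / (1 + expR e)) `^ b.
Proof.
move=> e0 m10 m00.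
pose q : R := (1 + expR e)^-1.
have q0 : 0 < q by rewrite invr_gt0 addr_gt0 ?expR_gt0.
have aVb : a^-1 + b = 1 by rewrite /b addrC subrK.
have qa : q `^ a^-1 * q `^ b = q.
  by rewrite -powRD aVb ?oner_eq0// powRr1// ltW.
(* For weights [P] and [Q] the factors are [P / Q ^ b] and [(Q * m) ^ b]; since [a * b = a - 1], the
   [a]-th powers of the former sum to the Renyi moment. *)
have := @hoelder2 R (expR e * q `^ a^-1) (expR (- (b * e)) * q `^ a^-1)
  ((q * m1) `^ b) ((q * (expR e * m0)) `^ b) a b^-1
  (mulr_ge0 (expR_ge0 _) (powR_ge0 _ _)) (mulr_ge0 (expR_ge0 _) (powR_ge0 _ _))
  (powR_ge0 _ _) (powR_ge0 _ _) a_gt0.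
rewrite invr_gt0 invrK => /(_ b_gt0 aVb).
have -> : expR e * q `^ a^-1 * (q * m1) `^ b = q * (expR e * m1 `^ b).
  by rewrite powRM ?(ltW q0)// -[X in _ = X * _]qa; ring.
have -> : expR (- (b * e)) * q `^ a^-1 * (q * (expR e * m0)) `^ b = q * m0 `^ b.
  rewrite !powRM ?mulr_ge0 ?expR_ge0 ?(ltW q0)// -expRM -[X in _ = X * _]qa.
  by rewrite expRN [e * b]mulrC; field; rewrite gt_eqF ?expR_gt0.
rewrite -!powRrM mulfV ?gt_eqF// !powRr1 ?mulr_ge0 ?addr_ge0 ?expR_ge0
  ?(ltW q0)//.
rewrite -!mulrDr mulrC => /le_trans; apply.
rewrite [q * (_ + _)]mulrC ler_wpM2r ?powR_ge0//.
rewrite !powRM ?expR_ge0 ?powR_ge0// -!powRrM mulVf ?gt_eqF// powRr1 ?(ltW q0)//.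
rewrite -!expRM -mulrDl.
have -> : (a - 1) * (e ^+ 2 / 2) = (a * (a - 1) * (e ^+ 2 / 2)) * a^-1.
  by field; rewrite gt_eqF.
rewrite [leRHS]expRM ge0_ler_powR ?nnegrE ?invr_ge0 ?(ltW a_gt0) ?expR_ge0//.
  by rewrite mulr_ge0 ?addr_ge0 ?expR_ge0 ?ltW.
rewrite (le_trans _ (randomized_response_renyi e0))//.
rewrite [e * a]mulrC (_ : - (b * e) * a = - ((a - 1) * e))//.
by rewrite -ab; ring.
Qed.

Lemma powR_mul_le_mean (x y : R) : 0 <= x -> 0 <= y ->
  x `^ b * y `^ (1 - b) <= b * x + (1 - b) * y.
Proof.
move=> x0 y0; have b1 : 0 < 1 - b by rewrite /b subKr invr_gt0.
have := @conjugate_powR R (x `^ b) (y `^ (1 - b)) b^-1 (1 - b)^-1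
  (powR_ge0 _ _) (powR_ge0 _ _).
rewrite !invr_gt0 !invrK => /(_ b_gt0 b1 (subrKC b 1)).
by rewrite -!powRrM !mulfV ?gt_eqF// !powRr1// ![_ * b]mulrC [_ * (1 - b)]mulrC.
Qed.

(** Weighted AM-GM multiplied by [y ^ (b - 1)]; the right side is the tangent at [y]. *)
Lemma powR_le_tangent (x y : R) : 0 <= x -> 0 < y ->
  x `^ b <= b * y `^ (b - 1) * x + (1 - b) * y `^ b.
Proof.
move=> x0 y0; have yb : 0 < y `^ (b - 1) by rewrite powR_gt0.
have E r : y `^ r * y `^ (b - 1) = y `^ (r + (b - 1)).
  by rewrite -powRD// (gt_eqF y0) implybT.
have := ler_wpM2r (ltW yb) (powR_mul_le_mean x0 (ltW y0)).
rewrite -[x `^ b * _ * _]mulrA E subrKA subrr powRr0 mulr1 => /le_trans; apply.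
rewrite mulrDl [b * x * _]mulrAC lerD2l -[_ * y * _]mulrA.
by rewrite mulr_powRB1// ltW.
Qed.

(** A concave power is the infimum of its tangents, so Jensen's inequality can be proved one tangent
    at a time. For [0 < w] the tangent at [w] suffices. *)
Lemma le_powR_tangents (w z : R) : 0 <= w ->
  (forall y, 0 < y -> z <= b * y `^ (b - 1) * w + (1 - b) * y `^ b) ->
  z <= w `^ b.
Proof.
rewrite le_eqVlt => /predU1P[<- H|w0 /(_ w w0)]; last first.
  rewrite -mulrA [_ `^ (b - 1) * w]mulrC mulr_powRB1 ?(ltW w0)//.
  by rewrite -mulrDl addrC subrK mul1r.
rewrite powR0 ?gt_eqF// leNgt; apply/negP => z0.
(* At [w = 0] the slope is infinite; the tangent at [z ^ (1 / b)] gives [z <= (1 - b) * z], which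
   refutes [0 < z]. *)
have := H (z `^ b^-1) (powR_gt0 _ z0).
rewrite mulr0 add0r -powRrM mulVf ?gt_eqF// powRr1 ?(ltW z0)//.
by rewrite mulrBl mul1r lerBrDl gerDr leNgt mulr_gt0.
Qed.

End two_point.

Lemma powR_itv01 {R : realType} (x r : R) :
  0 <= r -> 0 <= x <= 1 -> 0 <= x `^ r <= 1.
Proof.
move=> r0 /andP[x0 x1]; rewrite powR_ge0/=.
have -> : 1 = 1 `^ r :> R by rewrite powR1.
by rewrite ge0_ler_powR ?nnegrE.
Qed.

(** * Integrals of powers under a pure privacy bound *)

Section private_integral.
Context {R : realType} d (Y : measurableType d).
Implicit Types (P Q : probability Y R) (e : R) (h : Y -> R).

Definition prob_ratio_le e P Q :=
  forall S, measurable S -> (P S <= (expR e)%:E * Q S)%E.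

Lemma ge0_integral_ratio_le e P Q (f : Y -> \bar R) : prob_ratio_le e P Q ->
  measurable_fun [set: Y] f -> (forall y, 0 <= f y)%E ->
  (\int[P]_y f y <= (expR e)%:E * \int[Q]_y f y)%E.
Proof.
move=> PQ mf f0.
rewrite -(ge0_integral_mscale _ _ (NngNum (expR_ge0 e)))//.
exact: ge0_le_measure_integral.
Qed.

Lemma bounded_integrable P h r : measurable_fun [set: Y] h ->
  (forall y, 0 <= h y <= r) -> P.-integrable [set: Y] (EFin \o h).
Proof.
move=> mh hr; apply: measurable_bounded_integrable => //.
  by apply: (le_lt_trans (probability_le1 P measurableT)); rewrite ltry.
exists r; split; first exact: num_real.
move=> x rx y _ /=; have /andP[h0 h1] := hr y.
by rewrite ger0_norm// (le_trans h1)// ltW.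
Qed.

Lemma Rintegral_ratio_le e P Q h r : prob_ratio_le e P Q ->
  measurable_fun [set: Y] h -> (forall y, 0 <= h y <= r) ->
  \int[P]_y h y <= expR e * \int[Q]_y h y.
Proof.
move=> PQ mh hr; rewrite -lee_fin EFinM /Rintegral !fineK; last 2 first.
- exact: (integrable_fin_num _ (bounded_integrable _ mh hr)).
- exact: (integrable_fin_num _ (bounded_integrable _ mh hr)).
apply: ge0_integral_ratio_le => //; first exact/measurable_EFinP.
by move=> y; rewrite lee_fin; case/andP: (hr y).
Qed.

End private_integral.

Section private_powR.
Context {R : realType} d (Y : measurableType d).
Variables (a : R) (e : R) (P Q : probability Y R) (h : Y -> R).
Hypotheses (a_gt1 : 1 < a) (e_gt0 : 0 < e).
Hypotheses (PQ : prob_ratio_le e P Q) (QP : prob_ratio_le e Q P).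
Hypotheses (mh : measurable_fun [set: Y] h) (h01 : forall y, 0 <= h y <= 1).

Let b := 1 - a^-1.

Let b_gt0 : 0 < b.
Proof. by rewrite subr_gt0 invf_lt1// (lt_trans _ a_gt1). Qed.

Let b_lt1 : b < 1.
Proof. by rewrite ltrBlDr ltrDl invr_gt0 (lt_trans _ a_gt1). Qed.

Let h0 y : 0 <= h y. Proof. by case/andP: (h01 y). Qed.

Let mhb : measurable_fun [set: Y] (fun y => h y `^ b).
Proof. exact: (measurableT_comp (measurable_powR b)). Qed.

Let hb01 y : 0 <= h y `^ b <= 1.
Proof. exact: powR_itv01 (ltW b_gt0) (h01 y). Qed.

Let ih (P' : probability Y R) := bounded_integrable P' mh h01.
Let ihb (P' : probability Y R) := bounded_integrable P' mhb hb01.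

(** Jensen's inequality for [(expR e * P' - Q') / (expR e - 1)], a probability measure by the ratio
    bound. The measure is never built: its integrals are written as differences. *)
Lemma ratio_le_jensen (P' Q' : probability Y R) : prob_ratio_le e Q' P' ->
  expR e * (\int[P']_y h y `^ b) - \int[Q']_y h y `^ b <= (expR e - 1) *
    ((expR e * (\int[P']_y h y) - \int[Q']_y h y) / (expR e - 1)) `^ b.
Proof.
move=> QP'; have c0 : 0 < expR e - 1 by rewrite subr_gt0 expR_gt1.
rewrite [leRHS]mulrC -ler_pdivrMr//; apply: (le_powR_tangents a_gt1) => //.
  by rewrite divr_ge0 ?(ltW c0)// subr_ge0 (Rintegral_ratio_le QP' mh h01).
move=> y y0; rewrite ler_pdivrMr//.
pose u := b * y `^ (b - 1); pose v := (1 - b) * y `^ b.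
have u0 : 0 <= u by rewrite mulr_ge0 ?powR_ge0// ltW.
have v0 : 0 <= v by rewrite mulr_ge0 ?powR_ge0// subr_ge0 ltW.
pose g z := (u * h z + v) - h z `^ b.
have iuh (M : probability Y R) :
    M.-integrable [set: Y] (EFin \o (fun z => u * h z)).
  apply: (@bounded_integrable _ _ _ _ _ u); first exact: measurable_funM.
  by move=> z; rewrite mulr_ge0//= ler_piMr//; case/andP: (h01 z).
have iv (M : probability Y R) : M.-integrable [set: Y] (EFin \o (fun z : Y => v)).
  by apply: (@bounded_integrable _ _ _ _ _ v) => // z; rewrite v0/=.
have iuhv (M : probability Y R) :
    M.-integrable [set: Y] (EFin \o (fun z => u * h z + v)).
  apply: (@bounded_integrable _ _ _ _ _ (u + v)).
    by apply: measurable_funD => //; exact: measurable_funM.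
  move=> z; case/andP: (h01 z) => hz0 hz1; apply/andP; split.
    by apply: addr_ge0 => //; exact: mulr_ge0.
  by rewrite lerD2r ler_piMr.
have gE (M : probability Y R) :
    \int[M]_z g z = u * (\int[M]_z h z) + v - \int[M]_z h z `^ b.
  rewrite (RintegralB measurableT (iuhv M) (ihb M)).
  rewrite (RintegralD measurableT (iuh M) (iv M)).
  rewrite (RintegralZl u measurableT (ih M)).
  rewrite Rintegral_cst// (_ : fine _ = 1) ?mulr1//.
  by rewrite -[RHS]/(fine 1%E) -(probability_setT M).
(* The ratio bound applies to [g], the nonnegative gap between tangent and power; expanding both
   integrals gives the inequality for this tangent. *)
have := @Rintegral_ratio_le _ _ _ e Q' P' g (u + v) QP'; rewrite !gE.
have mg : measurable_fun [set: Y] g.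
  apply: measurable_funB => //; apply: measurable_funD => //.
  exact: measurable_funM.
have g0 z : 0 <= g z <= u + v.
  rewrite subr_ge0 (powR_le_tangent a_gt1)//= lerBlDr ler_wpDr ?powR_ge0//.
  by rewrite lerD2r ler_piMr//; case/andP: (h01 z).
move=> /(_ mg g0); rewrite -[1 - a^-1]/b -/u -/v.
move: (\int[P']_z _) (\int[Q']_z _) (\int[P']_z _) (\int[Q']_z _).
move=> s1 s2 s3 s4 H.
rewrite mulrDl mulrA divfK ?gt_eqF//.
lra.
Qed.

(* With [P = p M1 + (1 - p) M0] and [Q = (1 - p) M1 + p M0], where
   [p = e^e / (1 + e^e)], Jensen's inequality for [M0] and [M1] reduces the
   bound to randomized response. *)
Lemma private_powR_integral :
  \int[P]_y h y `^ b <=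
  expR ((a - 1) * (e ^+ 2 / 2)) * (\int[Q]_y h y) `^ b.
Proof.
have := ratio_le_jensen QP; have := ratio_le_jensen PQ.
set p := Rintegral P _ h; set q := Rintegral Q _ h.
set pb := Rintegral P _ _; set qb := Rintegral Q _ _.
have c0 : 0 < expR e - 1 by rewrite subr_gt0 expR_gt1.
set m0 := (expR e * q - p) / _; set m1 := (expR e * p - q) / _.
move=> H0 H1.
have m00 : 0 <= m0.
  by rewrite divr_ge0 ?(ltW c0)// subr_ge0 (Rintegral_ratio_le PQ mh h01).
have m10 : 0 <= m1.
  by rewrite divr_ge0 ?(ltW c0)// subr_ge0 (Rintegral_ratio_le QP mh h01).
have := randomized_response_powR a_gt1 (ltW e_gt0) m10 m00.
rewrite (_ : (m1 + expR e * m0) / _ = q); last first.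
  rewrite /m1 /m0; field.
  by rewrite !gt_eqF// addr_gt0 ?expR_gt0.
apply: le_trans; rewrite ler_pdivlMr ?addr_gt0 ?expR_gt0//.
rewrite -(ler_pM2r c0).
(* Adding [expR e] times [H1] to [H0] cancels [qb] and leaves [(expR e ^+ 2 - 1) * pb]. *)
have := lerD (ler_wpM2l (expR_ge0 e) H1) H0.
lra.
Qed.

End private_powR.

(** * Privacy of Laplace noise vectors *)

Section product_ratio_le.
Context {R : realType} d1 d2 (X : measurableType d1) (Y : measurableType d2).
Variables (P : probability X R) (Q : probability Y R).
Variables (f : {mfun X >-> X}) (g : {mfun Y >-> Y})
  (fg : {mfun (X * Y)%type >-> (X * Y)%type}).
Hypothesis fgE : forall z, fg z = (f z.1, g z.2).

(** Budgets of independent coordinates add: [g] is removed on each section, then [f] in the outer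
    integral. *)
Lemma product_ratio_le e1 e2 : prob_ratio_le e1 (distribution P f) P ->
  prob_ratio_le e2 (distribution Q g) Q ->
  prob_ratio_le (e1 + e2) (distribution (P \x Q)%E fg) (P \x Q)%E.
Proof.
move=> fP gQ S mS; have mQS := measurable_fun_xsection Q mS.
apply: (@le_trans _ _ ((expR e2)%:E * \int[P]_x Q (xsection S (f x)))%E).
  rewrite -ge0_integralZl//; last exact: (measurableT_comp mQS).
  apply: ge0_le_integral => //=.
  - apply: measurable_fun_xsection; rewrite -[Z in measurable Z]setTI.
    exact: measurable_funPT.
  - by apply: measurable_funeM; exact: (measurableT_comp mQS).
  move=> x _; rewrite (_ : xsection _ x = g @^-1` (xsection S (f x))); last first.
    by apply/seteqP; split=> y; rewrite /= !xsectionE/= fgE.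
  by apply: gQ; exact: measurable_xsection.
rewrite addrC expRD EFinM -muleA lee_pmul2l ?lte_fin ?expR_gt0//.
rewrite -[Z in (Z <= _)%E](@ge0_integral_distribution _ _ _ _ _ P f _ mQS)//.
exact: ge0_integral_ratio_le.
Qed.

End product_ratio_le.

Section translation.
Context {R : realType}.
Notation mu := (@lebesgue_measure R).

Definition addc (c x : R) : R := x + c.

Lemma measurable_addc c : measurable_fun [set: R] (addc c).
Proof. exact: measurable_funD. Qed.

HB.instance Definition _ c :=
  isMeasurableFun.Build _ _ _ _ (addc c) (measurable_addc c).

(* The measure structure of [pushforward] depends on a measurability proof that
   canonical inference cannot supply. *)
Definition lebesgue_addc c : {measure set (measurableTypeR R) -> \bar R} :=
  @measure_function_pushforward__canonical__measure_function_Measure _ _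
    (measurableTypeR R) (measurableTypeR R) R mu (addc c) (measurable_addc c).

Lemma lebesgue_measure_addc c S : measurable S -> mu (addc c @^-1` S) = mu S.
Proof.
move=> mS.
rewrite [RHS](@lebesgue_measure_unique _ (lebesgue_addc c))// => _ [[x y] _ <-].
rewrite /lebesgue_addc/= /pushforward.
rewrite (_ : _ @^-1` _ = `]x - c, y - c]%classic); last first.
  by apply/seteqP; split=> z /=; rewrite !in_itv/= /addc ltrBlDr lerBrDr.
rewrite !lebesgue_measure_itv/= !lte_fin ltrD2r.
by case: ifPn => // _; rewrite -!EFinD opprB addrA subrK.
Qed.

Lemma laplace_pdf_addc_le (l c x : R) : 0 < l ->
  laplace_pdf l (x - c) <= expR (`|c| / l) * laplace_pdf l x.
Proof.
move=> l0; rewrite /laplace_pdf l0 mulrCA ler_wpM2l ?invr_ge0 ?mulr_ge0 ?(ltW l0)//.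
rewrite -expRD ler_expR -mulrDl ler_wpM2r ?invr_ge0 ?(ltW l0)//.
rewrite lerBrDr addrC lerBlDl -{1}(subrK c x).
exact: ler_normD.
Qed.

(** By translation invariance of Lebesgue measure the shifted law has density
    [laplace_pdf l (x - c)]; the pointwise ratio of densities is then integrated. *)
Lemma laplace_ratio_le (l c : R) : 0 < l ->
  prob_ratio_le (`|c| / l) (distribution (laplace_prob l) (addc c))
    (laplace_prob l).
Proof.
move=> l0 S mS.
change (\int[mu]_(x in addc c @^-1` S) (laplace_pdf l x)%:E <=
  (expR (`|c| / l))%:E * \int[mu]_(x in S) (laplace_pdf l x)%:E)%E.
have mpdf (k : R) : measurable_fun S (fun x => (laplace_pdf l (x - k))%:E).
  apply/measurable_funTS/measurable_EFinP.
  by apply: (measurableT_comp (measurable_laplace_pdf l)); exact: measurable_funB.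
have pdf0 x : (0 <= (laplace_pdf l x)%:E)%E by rewrite lee_fin laplace_pdf_ge0.
have -> : (\int[mu]_(x in addc c @^-1` S) (laplace_pdf l x)%:E =
           \int[mu]_(x in S) (laplace_pdf l (x - c))%:E)%E.
  have E := @ge0_integral_pushforward _ _ (measurableTypeR R) (measurableTypeR R) R
    (addc c) (measurable_addc c) mu S (fun x => (laplace_pdf l (x - c))%:E) mS
    (mpdf c) (fun x _ => pdf0 (x - c)).
  rewrite -[pushforward _ _]/(lebesgue_addc c : set _ -> _) in E.
  rewrite [LHS](@eq_measure_integral _ (measurableTypeR R) _ _ mu) in E; last first.
    by move=> B mB _; exact: lebesgue_measure_addc.
  by rewrite E; apply: eq_integral => x _; rewrite /= /addc addrK.
have mpdf0 : measurable_fun S (fun x => (laplace_pdf l x)%:E).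
  by have := mpdf 0; under eq_fun do rewrite subr0.
rewrite -ge0_integralZl//.
apply: ge0_le_integral => //.
- exact: mpdf.
- exact: (@measurable_funeM _ (measurableTypeR R) _ _ _ _ mpdf0).
- by move=> x _; rewrite -EFinM lee_fin laplace_pdf_addc_le.
Qed.

Definition translate n (c : 'I_n -> R) (x : n.-tuple R) : n.-tuple R :=
  [tuple tnth x i + c i | i < n].

Lemma measurable_translate n c : measurable_fun [set: n.-tuple R] (@translate n c).
Proof.
apply/measurable_fun_tnthP => i.
rewrite (_ : _ \o _ = fun x => tnth x i + c i); last first.
  by apply/funext => x /=; rewrite tnth_mktuple.
by apply: measurable_funD => //; exact: measurable_tnth.
Qed.

HB.instance Definition _ n c :=
  isMeasurableFun.Build _ _ _ _ (@translate n c) (@measurable_translate n c).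

Definition addc_translate n (c0 : R) (c : 'I_n -> R) (z : R * n.-tuple R) :=
  (addc c0 z.1, translate c z.2).

Lemma measurable_addc_translate n c0 c :
  measurable_fun [set: R * n.-tuple R] (@addc_translate n c0 c).
Proof.
apply/measurable_fun_pairP; split.
  exact: (measurableT_comp (measurable_addc c0) measurable_fst).
exact: (measurableT_comp (@measurable_translate n c) measurable_snd).
Qed.

HB.instance Definition _ n c0 c := isMeasurableFun.Build _ _ _ _
  (@addc_translate n c0 c) (@measurable_addc_translate n c0 c).

Lemma translate_tcons n (c : 'I_n.+1 -> R) z :
  translate c (tcons z) = tcons (addc_translate (c ord0) (c \o lift ord0) z).
Proof.
apply: eq_from_tnth => i; rewrite tnth_mktuple.
have [j ->|->] := unliftP ord0 i.
  by rewrite !tnthS tnth_mktuple.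
by rewrite !tnth0.
Qed.

(** Adding the budgets of the coordinates produces the L1 norm of the shift, the quantity that
    [row_close] controls. *)
Lemma iid_laplace_ratio_le n (l : R) (c : 'I_n -> R) : 0 < l ->
  prob_ratio_le (\sum_i `|c i| / l)
    (distribution (iid (laplace_prob l) n) (translate c))
    (iid (laplace_prob l) n).
Proof.
move=> l0; elim: n c => [|n IH] c S mS.
  rewrite big_ord0 ?mul0r expR0 mul1e /= /distribution /pushforward.
  rewrite (_ : _ @^-1` S = S)//.
  by apply/seteqP; split=> x; rewrite /= [translate _ _]tuple0 [x]tuple0.
rewrite big_ord_recl /= /distribution /pushforward.
have := product_ratio_le
  (fg := @addc_translate n (c ord0) (c \o lift ord0)) (fun=> erefl)
  (laplace_ratio_le (c ord0) l0) (IH (c \o lift ord0)).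
have mtS : measurable (@tcons R n @^-1` S).
  by rewrite -[Z in measurable Z]setTI; exact: measurable_tcons.
move=> /(_ _ mtS); apply: le_trans; rewrite le_eqVlt; apply/orP; left; apply/eqP.
rewrite /distribution /pushforward; congr product_measure1.
by apply/seteqP; split => z /=; rewrite translate_tcons.
Qed.

End translation.

Section prob_ratio_le_theory.
Context {R : realType}.

Lemma prob_ratio_leW d (Y : measurableType d) (P Q : probability Y R) (e e' : R) :
  e <= e' -> prob_ratio_le e P Q -> prob_ratio_le e' P Q.
Proof.
move=> ee' PQ S mS; apply: (le_trans (PQ S mS)).
by rewrite lee_wpmul2r// lee_fin ler_expR.
Qed.

Lemma translateNK n (c : 'I_n -> R) x :
  translate c (translate (fun i => - c i) x) = x.
Proof. by apply: eq_from_tnth => i; rewrite !tnth_mktuple addrNK. Qed.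

(** The previous bound for the shift [- c], applied to the preimage of the event under the shift
    [c]. *)
Lemma iid_laplace_translate_ratio_le n (l : R) (c : 'I_n -> R) : 0 < l ->
  prob_ratio_le (\sum_i `|c i| / l) (iid (laplace_prob l) n)
    (distribution (iid (laplace_prob l) n) (translate c)).
Proof.
move=> l0 S mS.
have mtS : measurable (translate c @^-1` S).
  by rewrite -[Z in measurable Z]setTI; exact: measurable_translate.
have E : translate (fun i => - c i) @^-1` (translate c @^-1` S) = S.
  by apply/seteqP; split=> x; rewrite /= translateNK.
rewrite -{1}E (eq_bigr (fun i => `|- c i| / l)); last by move=> i; rewrite normrN.
exact: (iid_laplace_ratio_le (fun i => - c i) l0 mtS).
Qed.

Lemma ge0_Rintegral_distribution d d' (X : measurableType d)
    (Y : measurableType d') (P : probability X R) (f : {mfun X >-> Y}) (h : Y -> R) :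
  measurable_fun [set: Y] h -> (forall y, 0 <= h y) ->
  \int[distribution P f]_y h y = \int[P]_x h (f x).
Proof.
move=> mh h0; congr fine; rewrite ge0_integral_distribution//.
exact/measurable_EFinP.
Qed.

End prob_ratio_le_theory.

(** * The multiplicative weights update *)

Section mw_update_theory.
Context {R : realType} (m n : nat).
Implicit Types (A : 'M[R]_(m.+1, n)) (x nu : n.-tuple R) (p : 'I_m.+1).

(** Oracle privacy is assumed on the simplex only, so the iterates must stay there. The normalizer
    is nonzero because each weight is a positive multiple of the old coordinate. *)
Lemma simplex_mw_update alpha A x p nu :
  simplex x -> simplex (mw_update alpha A x p nu).
Proof.
move=> [x0 x1].
have w0 i : 0 <= mw_weight alpha A x p nu i by rewrite mulr_ge0 ?expR_ge0.
have W0 : \sum_i mw_weight alpha A x p nu i != 0.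
  apply/eqP => W0; have : \sum_i tnth x i = 0; last first.
    by rewrite x1 => /eqP; rewrite oner_eq0.
  rewrite big1// => i _.
  have /eqP := psumr_eq0P (fun j _ => w0 j) W0 (erefl : xpredT i).
  by rewrite mulf_eq0 gt_eqF ?expR_gt0//= => /eqP.
split=> [i|]; first by rewrite tnth_mktuple divr_ge0// sumr_ge0.
under eq_bigr do rewrite tnth_mktuple.
by rewrite -mulr_suml divff.
Qed.

Lemma simplex_initial_state : (0 < n)%N -> simplex (@initial_state R n).1.
Proof.
move=> n0; split=> [i|]; first by rewrite tnth_mktuple invr_ge0.
under eq_bigr do rewrite tnth_mktuple.
by rewrite sumr_const card_ord -[LHS]mulr_natl divff// pnatr_eq0 -lt0n.
Qed.

(** The update sees the matrix only through the noised row, so changing the matrix amounts to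
    translating the noise. *)
Lemma next_state_translate alpha A A' s p nu :
  next_state alpha A (s, p, nu) =
  next_state alpha A' (s, p, translate (fun i => A p i - A' p i) nu).
Proof.
rewrite /next_state/=; congr pair; rewrite /mw_update.
have E i : mw_weight alpha A s.1 p nu i =
    mw_weight alpha A' s.1 p (translate (fun i => A p i - A' p i) nu) i.
  by rewrite /mw_weight /noisy_loss tnth_mktuple [A' p i + _]addrCA subrKC addrC.
apply: eq_from_tnth => i; rewrite !tnth_mktuple E; congr (_ / _).
exact: eq_bigr.
Qed.

End mw_update_theory.

(** * Induction over the remaining iterations *)

Section lp_run_renyi.
Context {R : realType} (m n : nat).
Variables (alpha D1 e a : R) (orc : oracle R m n) (v : 'cV[R]_m.+1).
Hypotheses (D1_gt0 : 0 < D1) (e_gt0 : 0 < e) (a_gt1 : 1 < a).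
Hypothesis orc_private : private_oracle D1 e orc.
Variable S : set (n.-tuple R).
Hypothesis mS : measurable S.

Local Notation state := (n.-tuple R * n.-tuple R)%type.
Local Notation noise := (iid (laplace_prob (D1 / e)) n).
Implicit Types A : 'M[R]_(m.+1, n).

Let b := 1 - a^-1.

Let b_gt0 : 0 < b.
Proof. by rewrite subr_gt0 invf_lt1// (lt_trans _ a_gt1). Qed.

Definition hit_prob A k (s : state) : R :=
  fine (lp_run alpha (D1 / e) orc v A k s S).

Lemma hit_probE A k s :
  lp_run alpha (D1 / e) orc v A k s S = (hit_prob A k s)%:E.
Proof.
rewrite fineK//.
exact: (fin_num_measure (pklaw (lp_run alpha (D1 / e) orc v A k) s)).
Qed.

Lemma hit_prob01 A k s : 0 <= hit_prob A k s <= 1.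
Proof.
rewrite -2!lee_fin -hit_probE measure_ge0/=.
exact: (probability_le1 (pklaw (lp_run alpha (D1 / e) orc v A k) s)).
Qed.

Lemma measurable_hit_prob A k : measurable_fun [set: state] (hit_prob A k).
Proof.
by apply: (measurableT_comp (fine_measurable _)) => //;
  exact: (measurable_kernel _ _ mS).
Qed.

Let hit_next A k s p nu := hit_prob A k (next_state alpha A (s, p, nu)).

Let measurable_hit_next A k s p : measurable_fun [set: n.-tuple R] (hit_next A k s p).
Proof.
apply: (measurableT_comp (measurable_hit_prob A k)).
apply: (measurableT_comp (measurable_next_state alpha A)).
exact: pair1_measurable.
Qed.

Let hit_next01 A k s p nu : 0 <= hit_next A k s p nu <= 1.
Proof. exact: hit_prob01. Qed.

Let hit_row A k s p := \int[noise]_nu hit_next A k s p nu.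

Let hit_row01 A k s p : 0 <= hit_row A k s p <= 1.
Proof.
have i := bounded_integrable noise (measurable_hit_next A k s p)
  (hit_next01 A k s p).
apply/andP; split.
  by apply: Rintegral_ge0 => nu _; case/andP: (hit_next01 A k s p nu).
have i1 : noise.-integrable [set: n.-tuple R] (EFin \o cst 1).
  by apply: (@bounded_integrable _ _ _ _ _ 1) => // nu; rewrite ler01/=.
apply: (@le_trans _ _ (\int[noise]_nu 1)).
  by apply: le_Rintegral => // nu _; case/andP: (hit_next01 A k s p nu).
by rewrite Rintegral_cst// mul1r -[leRHS]/(fine 1%E) -(probability_setT noise).
Qed.

Let measurable_hit_row A k s : measurable_fun [set: 'I_m.+1] (hit_row A k s).
Proof. by []. Qed.

Lemma hit_probS A k s :
  hit_prob A k.+1 s = \int[pklaw (orc v A) s.1]_p hit_row A k s p.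
Proof.
rewrite /hit_prob lp_runS; congr fine; apply: eq_integral => p _.
rewrite /hit_row /Rintegral fineK; last first.
  exact: (integrable_fin_num _ (bounded_integrable _
    (measurable_hit_next A k s p) (hit_next01 A k s p))).
by apply: eq_integral => nu _; rewrite hit_probE.
Qed.

(** [private_powR_integral] pulls the power [b] out of the integral unchanged, so private draws can
    be chained at a fixed order. The state is generalized because the induction hypothesis is used
    at the random next state. *)
Lemma hit_prob_renyi A A' k s : unit_bounded A -> unit_bounded A' ->
  row_close D1 A A' -> simplex s.1 ->
  hit_prob A k s <= expR ((a - 1) * (k%:R * e ^+ 2)) * hit_prob A' k s `^ b.
Proof.
move=> A1 A'1 AA'; elim: k s => [|k IH] s s1.
  rewrite mul0r mulr0 expR0 mul1r.
  have E B : hit_prob B 0 s = \1_S (average alpha s) by [].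
  (* With no draw left the probability is [0] or [1], and a positive power fixes both. *)
  rewrite !E indicE; case: (_ \in _); first by rewrite powR1.
  by rewrite powR0// gt_eqF.
have row_le p : hit_row A k s p <= expR ((a - 1) * (k%:R * e ^+ 2)) *
    (expR ((a - 1) * (e ^+ 2 / 2)) * hit_row A' k s p `^ b).
  pose c i := A p i - A' p i.
  have cl : \sum_i `|c i| / (D1 / e) <= e.
    by rewrite -mulr_suml ler_pdivrMr ?divr_gt0// mulrC divfK ?gt_eqF// AA'.
  have l0 : 0 < D1 / e by rewrite divr_gt0.
  (* The row difference has L1 norm at most [D1] and the noise has scale [D1 / e], so shifted and
     unshifted noise are within ratio [expR e]. *)
  have := private_powR_integral a_gt1 e_gt0
    (prob_ratio_leW cl (iid_laplace_ratio_le c l0))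
    (prob_ratio_leW cl (iid_laplace_translate_ratio_le c l0))
    (measurable_hit_next A' k s p) (hit_next01 A' k s p).
  rewrite -(ler_pM2l (expR_gt0 ((a - 1) * (k%:R * e ^+ 2)))).
  apply: le_trans.
  have mh : measurable_fun [set: n.-tuple R] (fun nu => hit_next A' k s p nu `^ b).
    by apply: (measurableT_comp (measurable_powR b)); exact: measurable_hit_next.
  rewrite ge0_Rintegral_distribution//; last by move=> nu; rewrite powR_ge0.
  have hb01 nu : 0 <= hit_next A' k s p (translate c nu) `^ b <= 1.
    exact: powR_itv01 (ltW b_gt0) (hit_next01 _ _ _ _ _).
  have mhb : measurable_fun [set: n.-tuple R]
      (fun nu => hit_next A' k s p (translate c nu) `^ b).
    by apply: (measurableT_comp mh); exact: measurable_translate.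
  have ihb := bounded_integrable noise mhb hb01.
  rewrite -RintegralZl//; apply: le_Rintegral => //.
  - exact: bounded_integrable (measurable_hit_next A k s p) (hit_next01 A k s p).
  - apply: (@bounded_integrable _ _ _ _ _ (expR ((a - 1) * (k%:R * e ^+ 2)))).
      exact: measurable_funM.
    move=> nu; case/andP: (hb01 nu) => h0 h1.
    by rewrite mulr_ge0 ?expR_ge0//= ler_piMr ?expR_ge0.
  (* Once the noise is translated, both matrices reach the same next state, where the induction
     hypothesis applies. *)
  move=> nu _; rewrite /hit_next (next_state_translate _ A A').
  by apply: IH; exact: simplex_mw_update.
have ratio B B' : unit_bounded B -> unit_bounded B' -> row_close D1 B B' ->
    prob_ratio_le e (pklaw (orc v B) s.1) (pklaw (orc v B') s.1).
  by move=> B1 B'1 BB' U mU; have := orc_private s1 v B1 B'1 BB' mU; rewrite adde0.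
have A'A : row_close D1 A' A.
  by move=> i; under eq_bigr do rewrite distrC; exact: AA'.
have orc_le := private_powR_integral a_gt1 e_gt0 (ratio _ _ A1 A'1 AA')
  (ratio _ _ A'1 A1 A'A) (measurable_hit_row A' k s) (hit_row01 A' k s).
rewrite !hit_probS.
set K := expR ((a - 1) * (k%:R * e ^+ 2)) in row_le *.
set L := expR ((a - 1) * (e ^+ 2 / 2)) in row_le orc_le *.
(* One factor [L] pays for the noise and one for the oracle call. *)
have -> : expR ((a - 1) * (k.+1%:R * e ^+ 2)) = K * L * L.
  by rewrite -!expRD; congr expR; rewrite -natr1; field.
have KL0 : 0 <= K * L by rewrite mulr_ge0 ?expR_ge0.
rewrite -[leRHS]mulrA; apply: le_trans (ler_wpM2l KL0 orc_le).
have mrb : measurable_fun [set: 'I_m.+1] (fun p => hit_row A' k s p `^ b) by [].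
have rb01 p : 0 <= hit_row A' k s p `^ b <= 1.
  exact: powR_itv01 (ltW b_gt0) (hit_row01 _ _ _ _).
have irb := bounded_integrable (pklaw (orc v A) s.1) mrb rb01.
rewrite -RintegralZl//; apply: le_Rintegral => //.
- exact: bounded_integrable (measurable_hit_row A k s) (hit_row01 A k s).
- apply: (@bounded_integrable _ _ _ _ _ (K * L)) => //.
  move=> p; case/andP: (rb01 p) => h0 h1.
  by rewrite mulr_ge0//= ler_piMr.
by move=> p _; rewrite -mulrA.
Qed.

End lp_run_renyi.

(** * From the Renyi bound to approximate privacy *)

(** The last hypothesis bounds the factor by [expR (eps * (1 - a^-1)) * delta ^ (1 / a)]; weighted
    AM-GM of [expR eps * y] and [delta] concludes, both weights being at most [1]. *)
Lemma approximate_of_renyi {R : realType} (a eps delta rho x y : R) :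
  1 < a -> 0 < delta -> 0 <= y ->
  x <= expR ((a - 1) * rho) * y `^ (1 - a^-1) ->
  (a - 1) * (a * rho) + ln delta^-1 <= (a - 1) * eps ->
  x <= expR eps * y + delta.
Proof.
move=> a1 d0 y0 xy H; have a0 : 0 < a by exact: lt_trans a1.
have b0 : 0 <= 1 - a^-1 by rewrite subr_ge0 invf_le1// ltW.
have ey0 : 0 <= expR eps * y by rewrite mulr_ge0 ?expR_ge0.
apply: (le_trans xy).
have := powR_mul_le_mean a1 ey0 (ltW d0).
rewrite subKr => /le_trans-/(_ (expR eps * y + delta)) K.
apply: le_trans (K _).
  rewrite powRM ?expR_ge0// -expRM mulrAC ler_wpM2r ?powR_ge0//.
  rewrite -[in leRHS](lnK (x := delta)) ?posrE// -expRM -expRD ler_expR.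
  rewrite lnV ?posrE// in H.
  rewrite -(ler_pM2l a0) mulrDr [a * (_ * a^-1)]mulrC divfK ?gt_eqF//.
  rewrite [a * (eps * _)]mulrCA mulrBr mulr1 divff ?gt_eqF//.
  lra.
by rewrite lerD// ?ler_piMl// ?(ltW d0)// ?lerBlDr ?lerDl
  ?invr_ge0 ?ltW// invf_lt1.
Qed.

Lemma iter_eps_gt0 (R : realType) (n : nat) (alpha eps delta : R) :
  0 < eps -> 0 < ln delta^-1 -> (0 < num_iter n alpha)%N ->
  0 < iter_eps n alpha eps delta.
Proof.
by move=> e0 L0 T0; rewrite divr_gt0// mulr_gt0// sqrtr_gt0 mulr_gt0// ltr0n.
Qed.

Lemma sqr_iter_eps (R : realType) (n : nat) (alpha eps delta : R) :
  0 < ln delta^-1 -> (0 < num_iter n alpha)%N ->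
  (num_iter n alpha)%:R * iter_eps n alpha eps delta ^+ 2 =
  eps ^+ 2 / (16 * ln delta^-1).
Proof.
rewrite -(ltr0n R) /iter_eps => L0 T0.
rewrite expr_div_n exprMn sqr_sqrtr; last by rewrite mulr_ge0// ltW.
by field; rewrite !gt_eqF.
Qed.

(** Here [ln 0] is [0] by convention. Hence a positive number of iterations forces [0 < n], which
    puts the uniform starting point on the simplex. *)
Lemma num_iter0 (R : realType) (alpha : R) : num_iter 0 alpha = 0%N.
Proof. by rewrite /num_iter ln0// mulr0 mul0r ceil0. Qed.

Theorem theorem31 (R : realType) (m n : nat)
    (eps delta D1 alpha alphaO gammaO : R) (orc : oracle R m n)
    (eps_gt0 : 0 < eps) (delta_gt0 : 0 < delta) (D1_gt0 : 0 < D1)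
    (alpha_gt0 : 0 < alpha) (eps_le : eps <= 8 * ln delta^-1)
    (orc_dual : dual_oracle alphaO gammaO orc)
    (orc_private : private_oracle D1 (iter_eps n alpha eps delta) orc) :
  low_sensitivity_column_private D1 eps delta
    (column_private_lp alpha D1 (iter_eps n alpha eps delta) orc).
Proof.
move=> b A A' A1 A'1 AA' S mS.
(* Positivity of [eps] and [eps_le] together force [delta < 1]. *)
have L0 : 0 < ln delta^-1.
  by rewrite -(pmulr_rgt0 (x := 8))// (lt_le_trans eps_gt0).
set e := iter_eps n alpha eps delta.
pose T := num_iter n alpha; pose s0 : n.-tuple R * n.-tuple R := initial_state n.
change (lp_run alpha (D1 / e) orc b A T s0 S <=
  (expR eps)%:E * lp_run alpha (D1 / e) orc b A' T s0 S + delta%:E)%E.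
rewrite !hit_probE// -EFinM -EFinD lee_fin.
have /andP[h'0 h'1] := hit_prob01 alpha D1 e orc b mS A' T s0.
(* For [T = 0] division by zero makes [e] equal to [0], so this case is separate: the output then
   ignores the matrix. *)
have [T0|T_gt0] := posnP T.
  have -> : hit_prob alpha D1 e orc b S A T s0 =
      hit_prob alpha D1 e orc b S A' T s0.
    by rewrite T0.
  by rewrite ler_wpDr ?(ltW delta_gt0)// ler_peMl// ltW// expR_gt1.
have n_gt0 : (0 < n)%N.
  by rewrite lt0n; apply/eqP => n0; move: T_gt0; rewrite /T n0 num_iter0.
have e_gt0 : 0 < e by exact: iter_eps_gt0.
(* With [rho = eps ^+ 2 / (16 * L)], the value [a - 1 = sqrt (L / rho)] minimizes
   [a * rho + L / (a - 1)], which has to be at most [eps]. *)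
pose a := 1 + 4 * ln delta^-1 / eps.
have a_gt1 : 1 < a by rewrite ltrDl divr_gt0// mulr_gt0.
have := hit_prob_renyi alpha b D1_gt0 e_gt0 a_gt1 orc_private mS T A1 A'1 AA'
  (simplex_initial_state n_gt0).
move=> /approximate_of_renyi; apply => //.
rewrite sqr_iter_eps// /a.
move: (ln delta^-1) L0 eps_le => L L0 eL.
(* The two sides are [2 * L + eps / 4] and [4 * L]. *)
rewrite -subr_ge0 (_ : _ - _ = (8 * L - eps) / 4); last first.
  by field; rewrite !gt_eqF.
by rewrite mulr_ge0 ?divr_ge0 ?subr_ge0.
Qed.
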